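(* Let $E$ be a Banach space, let $G_0$ and $G_1$ be separable Gurarij spaces containing $E$, each atomic over $E$, and let $E \subseteq F \subseteq G_0$ with $\dim F/E$ finite. Also let $\varphi \colon F \to G_1$ be an isometric embedding extending $\mathrm{id}_E$. Then for any $\varepsilon > 0$ there exists an isometric isomorphism $\psi \colon G_0 \cong G_1$ extending $\mathrm{id}_E$ with $\|\psi|_F - \varphi\| < \varepsilon$. In particular, any two separable Gurarij spaces atomic over $E$ are isometrically isomorphic over $E$ (i.e., by an isomorphism extending $\mathrm{id}_E$).
   Context: All spaces are real; inclusions, embeddings and isomorphisms of normed spaces are linear and isometric. Types. For a Banach space $E$ and $n \in \mathbb{N}$, let $E(n) = E \oplus \bigoplus_{i<n} \mathbb{R} x_i$, with formal variables $x_i$. The space of $n$-types $S_n(E)$ is the set of all semi-norms on $E(n)$ extending the norm of $E$; the semi-norm corresponding to $\xi \in S_n(E)$ is written $\|\cdot\|^\xi$. If $E \subseteq F$ are Banach spaces and $\bar a \in F^n$, then $\mathrm{tp}(\bar a/E) \in S_n(E)$ is the semi-norm $b + \sum \lambda_i x_i \mapsto \| b + \sum \lambda_i a_i \|$; $\bar a$ realises $\xi$ if $\xi = \mathrm{tp}(\bar a/E)$. The topology on $S_n(E)$ is the least one making $\xi \mapsto \|x\|^\xi$ continuous for every $x \in E(n)$. The distance $d(\xi,\zeta)$ is the infimum, over all Banach spaces $F \supseteq E$ and all realisations $\bar a,\bar b \in F^n$ of $\xi,\zeta$ respectively, of $\sup_i \|a_i - b_i\|$. A type $\xi$ is isolated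 if every metric neighbourhood of $\xi$ is also a neighbourhood of $\xi$ in the topology. For $E \subseteq F$, $F$ is atomic over $E$ if the type over $E$ of every finite tuple in $F$ is isolated. A Gurarij space is a Banach space $G$ such that for any $\varepsilon > 0$, finite-dimensional Banach spaces $E \subseteq F$ and isometric embedding $\varphi \colon E \to G$, there is a linear map $\psi \colon F \to G$ extending $\varphi$ with $(1-\varepsilon)\|x\| \leq \|\psi x\| \leq (1+\varepsilon)\|x\|$ for all $x \in F$. *)

(* Defs.v *)
From HB Require Import structures.
From mathcomp Require Import all_boot all_order all_algebra.
From mathcomp Require Import all_classical all_reals all_analysis.

Set Implicit Arguments.
Unset Strict Implicit.
Unset Printing Implicit Defensive.

Import Order.TTheory GRing.Theory Num.Theory.
Import numFieldNormedType.Exports.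

Local Open Scope classical_set_scope.
Local Open Scope ring_scope.

(* An inclusion [E `<=` F] of normed spaces is rendered as the datum of a
   linear isometric map, not necessarily onto. *)
Record embedding (R : realType) (E F : normedModType R) := Embedding {
  emb_linear :> {linear E -> F} ;
  emb_isometric : forall x : E, `|emb_linear x| = `|x| }.

Definition separable (T : topologicalType) : Prop :=
  exists2 D : set T, countable D & dense D.

Definition finite_dimensional (R : realType) (V : lmodType R) : Prop :=
  exists (n : nat) (f : 'I_n -> V), forall x : V,
    exists c : 'I_n -> R, x = \sum_(i < n) c i *: f i.

(* [dim F / E < oo]: finitely many classes span the quotient of [F] by the
   image of [E]. *)
Definition finite_codimensional (R : realType) (E F : normedModType R)
    (j : embedding E F) : Prop :=
  exists (n : nat) (f : 'I_n -> F), forall x : F,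
    exists (e : E) (c : 'I_n -> R), x = j e + \sum_(i < n) c i *: f i.

(* Valued in the extended reals, so that an unbounded map has norm [+oo]. *)
Definition opnorm (R : realType) (V W : normedModType R) (f : V -> W) : \bar R :=
  ereal_sup [set (`|f x|)%:E | x in [set x : V | `|x| <= 1]].

(* The pair [(b, c) : E * 'rV_n] stands for [b + \sum_i c 0 i * x_i] in
   [E(n)].  Nonnegativity follows from the other axioms of a semi-norm. *)
Record ntype (R : realType) (E : normedModType R) (n : nat) := NType {
  tnorm :> E * 'rV[R]_n -> R ;
  tnormD : forall x y, tnorm (x + y) <= tnorm x + tnorm y ;
  tnormZ : forall (a : R) x, tnorm (a *: x) = `|a| * tnorm x ;
  tnorm_extends : forall b : E, tnorm (b, 0) = `|b| }.

HB.instance Definition _ (R : realType) (E : normedModType R) (n : nat) :=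
  gen_eqMixin (ntype E n).
HB.instance Definition _ (R : realType) (E : normedModType R) (n : nat) :=
  gen_choiceMixin (ntype E n).
HB.instance Definition _ (R : realType) (E : normedModType R) (n : nat) :=
  Topological.copy (ntype E n)
    (sup_topology (fun x : E * 'rV[R]_n =>
      Topological.on (initial_topology (fun xi : ntype E n => xi x)))).

Section TypeOfTuple.
Variables (R : realType) (E F : normedModType R) (j : embedding E F).
Variables (n : nat) (a : 'I_n -> F).

Definition tp_norm (x : E * 'rV[R]_n) : R :=
  `|j x.1 + \sum_(i < n) x.2 0 i *: a i|.

Lemma tp_normD x y : tp_norm (x + y) <= tp_norm x + tp_norm y.
Proof.
rewrite /tp_norm /= linearD.
under eq_bigr do rewrite mxE scalerDl.
by rewrite big_split /= addrACA ler_normD.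
Qed.

Lemma tp_normZ (c : R) x : tp_norm (c *: x) = `|c| * tp_norm x.
Proof.
rewrite /tp_norm /= linearZ.
under eq_bigr do rewrite mxE -scalerA.
by rewrite -scaler_sumr -scalerDr normrZ.
Qed.

Lemma tp_norm_extends (b : E) : tp_norm (b, 0) = `|b|.
Proof.
rewrite /tp_norm /= big1 ?addr0 ?emb_isometric// => i _.
by rewrite mxE scale0r.
Qed.

Definition tp : ntype E n := NType tp_normD tp_normZ tp_norm_extends.

End TypeOfTuple.

Definition tdist (R : realType) (E : normedModType R) (n : nat)
    (xi zeta : ntype E n) : \bar R :=
  ereal_inf [set r : \bar R |
    exists (F : completeNormedModType R) (j : embedding E F)
           (a b : 'I_n -> F),
      [/\ tp j a = xi, tp j b = zeta &
          r = (\big[Num.max/0]_(i < n) `|a i - b i|)%:E]].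

Definition metric_nbhs (R : realType) (E : normedModType R) (n : nat)
    (xi : ntype E n) (V : set (ntype E n)) : Prop :=
  exists2 eps : R, 0 < eps & [set zeta | (tdist xi zeta < eps%:E)%E] `<=` V.

Definition isolated (R : realType) (E : normedModType R) (n : nat)
    (xi : ntype E n) : Prop :=
  forall V : set (ntype E n), metric_nbhs xi V -> nbhs xi V.

Definition atomic_over (R : realType) (E F : normedModType R)
    (j : embedding E F) : Prop :=
  forall (n : nat) (a : 'I_n -> F), isolated (tp j a).

Definition gurarij (R : realType) (G : completeNormedModType R) : Prop :=
  forall (eps : R), 0 < eps ->
  forall (E F : completeNormedModType R) (j : embedding E F)
         (phi : embedding E G),
    finite_dimensional E -> finite_dimensional F ->
    exists psi : {linear F -> G},
      (forall e : E, psi (j e) = phi e) /\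
      (forall x : F, (1 - eps) * `|x| <= `|psi x| <= (1 + eps) * `|x|).

(* Main.v *)
From HB Require Import structures.
Require Import Defs.
From mathcomp Require Import all_boot all_order all_algebra.
From mathcomp Require Import all_classical all_reals all_analysis.
From mathcomp Require Import lra ring.
Import Order.TTheory GRing.Theory Num.Theory.
Import numFieldNormedType.Exports.
Local Open Scope classical_set_scope.
Local Open Scope ring_scope.

(** The isomorphism is built by a back-and-forth between two sequences of
    tuples, [a] in [G0] and [b] in [G1], that have the same type over [E] at
    every stage.

    The crux is one extension step: given tuples [a] and [b] of the same type
    and a new point [x] of [G0], find a tuple of [G1] that realises the type of
    [(a, x)] over [E] exactly and whose first part is as close to [b] as
    prescribed ([extend_same_type]).  The Gurarij property only extends
    finite-dimensional spaces, and only up to a factor [1 +- eps], whereas a type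
    over [E] involves all of [E] and must be matched exactly.  Isolation bridges
    both gaps: a metric neighbourhood of an isolated type contains a topological
    one, which is controlled by finitely many vectors of [E(n)], up to some
    error.  So approximating the seminorm on the span of finitely many vectors
    of [E] suffices to come metrically close to the type
    ([isolated_extension]).

    An exact realisation is then a limit.  If [g] realises a type [xi] close to
    the isolated type [zeta], amalgamating the two types over [E] gives a
    seminorm on [E] plus two tuples of variables in which the tuples are close
    to each other ([near_type_amalgam]).  Approximating this seminorm over [g]
    yields a tuple near [g] whose type is much closer to [zeta].  Iterating with
    geometrically decreasing errors converges ([isolated_realized]).

    Isolation is used on types of tuples of [G0] and of [G1], so atomicity lets
    the step run in both directions.  Feeding dense sequences of [G0] and [G1]
    alternately, with errors [eps / 2 ^ k], every coordinate of the tuples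
    converges; the limit sequences [al] and [be] are dense and have the same
    type over [E], so [al k |-> be k] extends to the required isomorphism
    ([back_and_forth], [matched_isomorphism]).  Started from a tuple spanning
    [F] over [E], it moves this tuple by little.  To turn that into an operator
    norm estimate, vectors of the unit ball of [F] need coordinates of bounded
    size, which holds because [E] is complete and [F / E] finite-dimensional
    ([finite_codimensional_bounded_coeffs]). *)

Set Implicit Arguments.
Unset Strict Implicit.
Unset Printing Implicit Defensive.

(** * Seminorms *)

Definition seminorm (R : realType) (V : lmodType R) (p : V -> R) : Prop :=
  (forall x y, p (x + y) <= p x + p y) /\
  (forall (a : R) x, p (a *: x) = `|a| * p x).

Section SeminormTheory.
Variables (R : realType) (V : lmodType R) (p : V -> R).
Hypothesis sp : seminorm p.

Lemma seminormD x y : p (x + y) <= p x + p y. Proof. exact: sp.1. Qed.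

Lemma seminormZ (a : R) x : p (a *: x) = `|a| * p x. Proof. exact: sp.2. Qed.

Lemma seminorm0 : p 0 = 0.
Proof. by rewrite -[0](scale0r 0) seminormZ normr0 mul0r. Qed.

Lemma seminormN x : p (- x) = p x.
Proof. by rewrite -scaleN1r seminormZ normrN normr1 mul1r. Qed.

Lemma seminorm_ge0 x : 0 <= p x.
Proof.
have := seminormD x (- x); rewrite subrr seminorm0 seminormN; lra.
Qed.

Lemma seminormB x y : p (x - y) <= p x + p y.
Proof. by rewrite -(seminormN y) seminormD. Qed.

Lemma seminorm_distC x y : p (x - y) = p (y - x).
Proof. by rewrite -seminormN opprB. Qed.

Lemma seminorm_eq x y : p (x - y) = 0 -> p x = p y.
Proof.
move=> pxy; have := seminormD (x - y) y; have := seminormD (y - x) x.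
rewrite -[p (y - x)]seminorm_distC !subrK pxy; lra.
Qed.

End SeminormTheory.

Lemma seminorm_comp (R : realType) (V W : lmodType R) (p : W -> R)
    (f : {linear V -> W}) : seminorm p -> seminorm (p \o f).
Proof.
move=> sp; split=> [x y|a x] /=; first by rewrite linearD seminormD.
by rewrite linearZ seminormZ.
Qed.

Section InfSeminorm.
Variables (R : realType) (A B : lmodType R) (N : A * B -> R).
Hypothesis sN : seminorm N.

Definition inf_norm (a : A) : R := inf [set N (a, b) | b in [set: B]].

Lemma inf_norm_le a b : inf_norm a <= N (a, b).
Proof.
apply: ge_inf; last by exists b.
by exists 0 => _ [c _ <-]; exact: seminorm_ge0.
Qed.

Lemma le_inf_norm a r : (forall b, r <= N (a, b)) -> r <= inf_norm a.
Proof.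
move=> rN; apply: lb_le_inf; first by exists (N (a, 0)), 0.
by move=> _ [b _ <-].
Qed.

(** The quotient seminorm of [N] along the projection [A * B -> A]; infimal
    convolutions arise in this way. *)
Lemma inf_norm_seminorm : seminorm inf_norm.
Proof.
have ge0 x : 0 <= inf_norm x by apply: le_inf_norm => b; exact: seminorm_ge0.
have Zle a x : inf_norm (a *: x) <= `|a| * inf_norm x.
  have [->|a0] := eqVneq a 0.
    by rewrite scale0r normr0 mul0r (le_trans (inf_norm_le 0 0))//
      (seminorm0 sN).
  rewrite -ler_pdivrMl ?normr_gt0//; apply: le_inf_norm => b.
  rewrite ler_pdivrMl ?normr_gt0// (le_trans (inf_norm_le _ (a *: b)))//.
  by rewrite -[(a *: x, _)]/(a *: (x, b)) (seminormZ sN).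
split=> [x y|a x].
  rewrite -lerBlDr; apply: le_inf_norm => b; rewrite lerBlDr -lerBlDl.
  apply: le_inf_norm => c; rewrite lerBlDl.
  exact: le_trans (inf_norm_le _ (b + c)) (seminormD sN (x, b) (y, c)).
apply/eqP; rewrite eq_le Zle/=.
have [->|a0] := eqVneq a 0; first by rewrite normr0 mul0r.
have := Zle a^-1 (a *: x).
by rewrite scalerA mulVf// scale1r normfV ler_pdivlMl ?normr_gt0.
Qed.

End InfSeminorm.

(** * Adding finitely many dimensions to a complete subspace *)

Definition complete_set (R : realType) (F : normedModType R) (S : set F) :=
  forall G : set_system F, ProperFilter G -> G S -> cauchy G ->
  exists2 s, S s & G --> s.

Definition add_span (R : realType) (F : lmodType R) (S : set F) (n : nat)
    (f : 'I_n -> F) : set F :=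
  [set x | exists2 s, S s & exists c : 'I_n -> R,
    x = s + \sum_(i < n) c i *: f i].

Lemma cauchy_lipschitz (R : realType) (F H : normedModType R) (A : set F)
    (h : F -> H) (L : R) (G : set_system F) : ProperFilter G ->
  (forall x y, A x -> A y -> `|h x - h y| <= L * `|x - y|) ->
  G A -> cauchy G -> cauchy (h @ G).
Proof.
move=> PG lip GA cG; apply: cauchy_exP => e e0.
have L0 : 0 < `|L| + 1 by rewrite ltr_wpDl.
have d0 : 0 < e / (`|L| + 1) / 2 by rewrite !divr_gt0.
have /cauchyP/(_ _ d0)[x Gx] := cG.
have GAx : G (A `&` ball x (e / (`|L| + 1) / 2)) by exact: filterI.
have [y [Ay yx]] := filter_ex GAx.
exists (h y); rewrite /fmap/=; apply: filterS GAx => z [Az zx] /=.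
rewrite -ball_normE /=; apply: le_lt_trans (lip _ _ Ay Az) _.
have yz : `|y - z| < e / (`|L| + 1).
  move: yx zx; rewrite -!ball_normE /= => yx zx.
  rewrite -[y](subrK x) -addrA (le_lt_trans (ler_normD _ _))//.
  by rewrite [ltRHS]splitr ltrD// distrC.
apply: (@le_lt_trans _ _ (`|L| * `|y - z|)); 
  first by rewrite ler_wpM2r// ler_norm.
apply: (@le_lt_trans _ _ ((`|L| + 1) * `|y - z|)); 
  first by rewrite ler_wpM2r// lerDl.
by rewrite mulrC -ltr_pdivlMr.
Qed.

Section CompleteSpan.
Variables (R : realType) (F : normedModType R).

(** A complete set is closed: points of [S] tending to [f] would form a Cauchy
    filter on [S], and its limit in [S] would be [f]. *)
Lemma complete_set_dist (S : set F) (f : F) : complete_set S -> ~ S f ->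
  exists2 d : R, 0 < d & forall s, S s -> d <= `|f - s|.
Proof.
move=> cS nSf; apply: contrapT => h.
have near_f (e : R) : 0 < e -> exists2 s, S s & `|f - s| < e.
  move=> e0; apply: contrapT => nfe; apply: h; exists e => // s Ss.
  by rewrite leNgt; apply/negP => fs; apply: nfe; exists s.
have Pf : ProperFilter (within S (nbhs f)).
  apply: within_nbhs_proper => /=.
  move=> B /nbhs_ballP [e /= e0 feB].
  have [s Ss fs] := near_f e e0; exists s; split => //.
  by apply: feB; rewrite -ball_normE.
have [||s Ss fs] := cS _ Pf; first by rewrite /within /=; near=> x.
- apply/cvg_cauchy/cvg_ex; exists f; exact: cvg_within.
- apply: nSf; suff -> : f = s by [].
  by apply: norm_cvg_unique fs => /=; exact: cvg_within.
Unshelve. all: by end_near. Qed.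

Definition submodule (S : set F) :=
  S 0 /\ forall (a : R) x y, S x -> S y -> S (a *: x + y).

(** When [f] is outside [S], its distance [d > 0] to [S] gives
    [d * `|c| <= `|s + c *: f|].  The coordinate along [f] is therefore
    Lipschitz on [S + R f], and a Cauchy filter on [S + R f] splits into a
    Cauchy filter of coordinates and one on [S]. *)
Lemma complete_add_line (S : set F) (f : F) : submodule S -> complete_set S ->
  complete_set [set x | exists2 s, S s & exists c : R, x = s + c *: f] /\
  exists2 C : R, 0 <= C & forall s (c : R), S s -> exists2 s', S s' &
    exists2 c' : R, s + c *: f = s' + c' *: f & `|c'| <= C * `|s + c *: f|.
Proof.
move=> [S0 SD] cS; have SB x y : S x -> S y -> S (x - y).
  by move=> Sx Sy; rewrite addrC -scaleN1r; apply: SD.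
have SZ (a : R) x : S x -> S (a *: x).
  by move=> Sx; rewrite -[_ *: _]addr0; apply: SD.
have [Sf|nSf] := pselect (S f).
  split; last first.
    exists 0 => // s c Ss; exists (s + c *: f).
      by rewrite addrC; exact: SD.
    by exists 0; rewrite ?scale0r ?addr0// normr0 mul0r.
  set T := [set _ | _]; suff -> : T = S by [].
  apply/seteqP; split => x; last first.
    by move=> Sx; exists x => //; exists 0; rewrite scale0r addr0.
  by move=> [s Ss [c ->]]; rewrite addrC; apply: SD.
have [d d0 dS] := complete_set_dist cS nSf.
have lb s (c : R) : S s -> `|c| <= d^-1 * `|s + c *: f|.
  move=> Ss; have [->|c0] := eqVneq c 0.
    by rewrite normr0 mulr_ge0// invr_ge0 ltW.
  rewrite ler_pdivlMl// mulrC;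
    apply: (@le_trans _ _ (`|c| * `|f - (- c^-1) *: s|)).
    by rewrite ler_wpM2l// dS//; apply: SZ.
  by rewrite -normrZ scalerBr scalerA mulrN divff// scaleN1r opprK addrC.
split; last first.
  exists d^-1; first by rewrite invr_ge0 ltW.
  by move=> s c Ss; exists s => //; exists c => //; exact: lb.
set T := [set _ | _] => G PG GT cG.
pose cf x := xget 0 [set c : R | S (x - c *: f)].
have cfP x : T x -> S (x - cf x *: f).
  move=> [s Ss [c ->]].
  by apply: (@xgetPex _ 0 [set c0 : R | S (s + c *: f - c0 *: f)]);
    exists c => /=; rewrite addrK.
have cfB x y : T x -> T y -> `|cf x - cf y| <= d^-1 * `|x - y|.
  move=> /cfP Sx /cfP Sy; have := lb _ (cf x - cf y) (SB _ _ Sx Sy).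
  suff -> : x - cf x *: f - (y - cf y *: f) + (cf x - cf y) *: f = x - y by [].
  by rewrite scalerBl opprB addrACA subrK [_ *: f - y]addrC addrK.
pose g x := x - cf x *: f.
have gB x y : T x -> T y -> `|g x - g y| <= (1 + d^-1 * `|f|) * `|x - y|.
  move=> Tx Ty; have -> : g x - g y = (x - y) - (cf x - cf y) *: f.
    by rewrite /g scalerBl !opprB [LHS]addrACA [RHS]addrACA [- y + _]addrC.
  rewrite (le_trans (ler_normB _ _))// normrZ mulrDl mul1r lerD2l.
  by rewrite mulrAC ler_wpM2r// cfB.
have := cauchy_lipschitz PG cfB GT cG => /R_complete/cvg_ex[/= c cfc].
have [||s Ss gs] := cS (g @ G); last 1 first.
- exists (s + c *: f); first by exists s => //; exists c.
  have gE : (fun x => g x + cf x *: f) = id by apply/funext => x; rewrite subrK.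
  suff : (fun x => g x + cf x *: f) @ G --> s + c *: f by rewrite gE.
  apply: (@cvgD _ _ _ G _ g (fun x => cf x *: f)) => //.
  by apply: (@cvgZ _ _ _ G _ cf (fun=> f)); [exact: cfc|exact: cvg_cst].
- by rewrite /fmap/=; apply: filterS GT => x /cfP.
- exact: (cauchy_lipschitz PG gB GT cG).
Qed.

(** Completeness and the bound on coefficients are proved together by induction:
    adding the next line needs completeness of what has been built, and the
    bounds on the successive coordinates compose. *)
Lemma complete_add_span (S : set F) (n : nat) (f : 'I_n -> F) :
  submodule S -> complete_set S ->
  complete_set (add_span S f) /\
  exists2 C : R, 0 <= C & forall x, add_span S f x ->
    exists2 s, S s & exists2 c : 'I_n -> R,
      x = s + \sum_(i < n) c i *: f i & \sum_(i < n) `|c i| <= C * `|x|.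
Proof.
move=> mS cS; elim: n f => [|n IH] f.
  split; last first.
    exists 0 => // x [s Ss [c ->]]; exists s => //; exists c => //.
    by rewrite big_ord0 mul0r.
  suff -> : add_span S f = S by [].
  apply/seteqP; split => x; last first.
    by move=> Sx; exists x => //; exists (fun=> 0); rewrite big_ord0 addr0.
  by move=> [s Ss [c ->]]; rewrite big_ord0 addr0.
pose f' := fun i : 'I_n => f (widen_ord (leqnSn n) i).
have [cS' [C C0 CP]] := IH f'.
have mS' : submodule (add_span S f').
  split.
    exists 0; first exact: mS.1.
    by exists (fun=> 0); rewrite big1 ?addr0// => i _; rewrite scale0r.
  move=> a x y [s Ss [c ->]] [t St [e ->]]; exists (a *: s + t).
    exact: mS.2.
  exists (fun i => a * c i + e i).
  under [in RHS]eq_bigr do rewrite scalerDl -scalerA.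
  by rewrite big_split/= -scaler_sumr scalerDr addrACA.
have [cS'' [D D0 DP]] := complete_add_line (f ord_max) mS' cS'.
have snoc (c : 'I_n -> R) (b : R) : exists2 c' : 'I_n.+1 -> R,
    \sum_(i < n) c i *: f' i + b *: f ord_max = \sum_(i < n.+1) c' i *: f i &
    \sum_(i < n) `|c i| + `|b| = \sum_(i < n.+1) `|c' i|.
  exists (fun i => if unlift ord_max i is Some j then c j else b).
    rewrite big_ord_recr /= unlift_none; congr (_ + _); apply: eq_bigr => i _.
    rewrite -[widen_ord _ i](_ : lift ord_max i = _); last first.
      by apply: val_inj; rewrite /= /bump leqNgt ltn_ord.
    rewrite liftK /f'; congr (_ *: f _).
    by apply: val_inj; rewrite /= /bump leqNgt ltn_ord.
  rewrite big_ord_recr /= unlift_none; congr (_ + _); apply: eq_bigr => i _.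
  rewrite -[widen_ord _ i](_ : lift ord_max i = _) ?liftK//.
  by apply: val_inj; rewrite /= /bump leqNgt ltn_ord.
have split_span x : add_span S f x -> exists2 s, add_span S f' s &
    exists c : R, x = s + c *: f ord_max.
  move=> [s Ss [c ->]]; rewrite big_ord_recr /= addrA.
  exists (s + \sum_(i < n) c (widen_ord (leqnSn n) i) *: f' i); last by
    exists (c ord_max).
  by exists s => //; exists (c \o widen_ord (leqnSn n)).
split.
  suff -> : add_span S f =
    [set x | exists2 s, add_span S f' s & exists c : R, x = s + c *: f ord_max].
    by [].
  apply/seteqP; split => x; first exact: split_span.
  move=> [_ [s Ss [c ->]] [b ->]]; have [c' e _] := snoc c b.
  by exists s => //; exists c'; rewrite -addrA e.
exists (C * (1 + D * `|f ord_max|) + D).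
  by rewrite addr_ge0// mulr_ge0// addr_ge0// mulr_ge0.
move=> x /split_span [y Sy [b xE]]; have [y' Sy' [b' e b'D]] := DP _ b Sy.
rewrite -xE in e b'D.
have [s Ss [c y'E cC]] := CP _ Sy'; have [c' c'E c'N] := snoc c b'.
exists s => //; exists c'; first by rewrite e y'E -addrA c'E.
rewrite -c'N mulrDl lerD// -mulrA (le_trans cC)// ler_wpM2l//.
have -> : y' = x - b' *: f ord_max by rewrite e addrK.
rewrite (le_trans (ler_normB _ _))// normrZ mulrDl mul1r lerD2l.
by rewrite mulrAC ler_wpM2r.
Qed.

Lemma finite_dimensional_complete : finite_dimensional F ->
  forall G : set_system F, ProperFilter G -> cauchy G -> cvg G.
Proof.
move=> [n [f spanf]] G PG cG.
have m0 : submodule [set 0 : F].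
  by split => // a x y /= -> ->; rewrite scaler0 addr0.
have c0 : complete_set [set 0 : F].
  move=> H PH H0 _; exists 0 => //= B B0; apply: filterS H0 => x /= ->.
  exact: nbhs_singleton.
have [/(_ G PG) + _] := complete_add_span f m0 c0; case => //.
  apply: filterS (@filterT _ G _) => x _.
  by have [c ->] := spanf x; exists 0 => //; exists c; rewrite add0r.
by move=> s _ Gs; apply/cvg_ex; exists s.
Qed.

End CompleteSpan.

(** * Finite-dimensional Banach spaces from seminorms *)

(** The proof argument is carried along so that the kernel can be a canonical
    additive subgroup, whose quotient is then a group. *)
Definition seminorm_kernel (R : realType) (V : lmodType R) (p : V -> R)
    (sp : seminorm p) : {pred V} := fun x => p x == 0.

Section SeminormQuotient.
Variables (R : realType) (V : lmodType R) (p : V -> R) (sp : seminorm p).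

Let kernel_zmod_closed : zmod_closed (seminorm_kernel sp).
Proof.
split=> [|x y /eqP px /eqP py].
  by rewrite unfold_in /seminorm_kernel seminorm0.
rewrite unfold_in /seminorm_kernel eq_le seminorm_ge0// andbT.
by rewrite (le_trans (seminormB sp x y))// px py addr0.
Qed.

HB.instance Definition _ :=
  GRing.isZmodClosed.Build V (seminorm_kernel sp) kernel_zmod_closed.

Definition seminorm_quotient : Type := Quotient.quot (seminorm_kernel sp).

HB.instance Definition _ := GRing.Zmodule.on seminorm_quotient.

Definition sq_proj (x : V) : seminorm_quotient :=
  (\pi_(Quotient.quot (seminorm_kernel sp)) x)%qT.

Definition sq_repr (x : seminorm_quotient) : V :=
  generic_quotient.repr (x : Quotient.quot (seminorm_kernel sp)).

Lemma sq_reprK x : sq_proj (sq_repr x) = x.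
Proof. exact: generic_quotient.reprK. Qed.

Lemma sq_projP x y : sq_proj x = sq_proj y <-> p (x - y) = 0.
Proof.
split=> [/eqP|/eqP] h; first by apply/eqP; move: h; rewrite -Quotient.idealrBE.
by apply/eqP; rewrite -Quotient.idealrBE.
Qed.

Lemma sq_projD x y : sq_proj (x + y) = sq_proj x + sq_proj y.
Proof. exact: Quotient.pi_add. Qed.

Definition sq_scale (a : R) (x : seminorm_quotient) : seminorm_quotient :=
  sq_proj (a *: sq_repr x).

Lemma sq_projZ a x : sq_scale a (sq_proj x) = sq_proj (a *: x).
Proof.
by apply/sq_projP; rewrite -scalerBr seminormZ// (sq_projP _ _).1 ?mulr0//
  sq_reprK.
Qed.

Let scaleA a b x : sq_scale a (sq_scale b x) = sq_scale (a * b) x.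
Proof. by rewrite -[x]sq_reprK !sq_projZ scalerA. Qed.

Let scale1 : left_id 1 sq_scale.
Proof. by move=> x; rewrite -[x]sq_reprK !sq_projZ scale1r. Qed.

Let scaleDr : right_distributive sq_scale +%R.
Proof.
move=> a x y; rewrite -[x]sq_reprK -[y]sq_reprK -sq_projD !sq_projZ.
by rewrite scalerDr sq_projD.
Qed.

Let scaleDl x : {morph sq_scale^~ x : a b / a + b}.
Proof.
by move=> a b; rewrite -[x]sq_reprK !sq_projZ scalerDl sq_projD.
Qed.

HB.instance Definition _ := GRing.Zmodule_isLmodule.Build R seminorm_quotient
  scaleA scale1 scaleDr scaleDl.

Definition sq_norm (x : seminorm_quotient) : R := p (sq_repr x).

Lemma sq_norm_proj x : sq_norm (sq_proj x) = p x.
Proof.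
by rewrite /sq_norm; apply: (seminorm_eq sp); apply/sq_projP; rewrite sq_reprK.
Qed.

Let normD x y : sq_norm (x + y) <= sq_norm x + sq_norm y.
Proof.
by rewrite -[x]sq_reprK -[y]sq_reprK -sq_projD !sq_norm_proj seminormD.
Qed.

Let normZ (a : R) (x : seminorm_quotient) : sq_norm (a *: x) = `|a| * sq_norm x.
Proof.
by rewrite -[x]sq_reprK [_ *: _]sq_projZ !sq_norm_proj seminormZ.
Qed.

Let norm_eq0 x : sq_norm x = 0 -> x = 0.
Proof.
rewrite -[x]sq_reprK sq_norm_proj => px.
have -> : 0 = sq_proj 0 by apply: (addrI (sq_proj 0)); rewrite -sq_projD !addr0.
by apply/sq_projP; rewrite subr0.
Qed.

HB.instance Definition _ :=
  Lmodule_isNormed.Build R seminorm_quotient normD normZ norm_eq0.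

Let proj_linear : linear sq_proj.
Proof. by move=> a x y; rewrite sq_projD -sq_projZ. Qed.

HB.instance Definition _ :=
  GRing.isLinear.Build R V seminorm_quotient *:%R sq_proj proj_linear.

Lemma norm_sq_proj x : `|sq_proj x| = p x.
Proof. exact: sq_norm_proj. Qed.

End SeminormQuotient.

Section SeminormQuotientBanach.
Variables (R : realType) (V : lmodType R) (p : V -> R) (sp : seminorm p).

Lemma seminorm_quotient_lift (W : normedModType R) (h : {linear V -> W}) :
  (forall v, `|h v| = p v) ->
  exists g : embedding (seminorm_quotient sp) W,
    forall v, g (sq_proj sp v) = h v.
Proof.
move=> hp; pose g (x : seminorm_quotient sp) : W := h (sq_repr x).
have gP v : g (sq_proj sp v) = h v.
  by apply/eqP; rewrite -subr_eq0 -normr_eq0 -linearB hp;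
    apply/eqP/(sq_projP sp)/sq_reprK.
have glin : linear g.
  move=> a x y; rewrite -[x]sq_reprK -[y]sq_reprK -linearP !gP.
  exact: linearP.
pose gL := HB.pack_for {linear seminorm_quotient sp -> W} g
  (GRing.isLinear.Build R (seminorm_quotient sp) W *:%R g glin).
have giso x : `|gL x| = `|x|.
  by rewrite -[x]sq_reprK norm_sq_proj [gL _]gP.
by exists (Embedding giso).
Qed.

Hypothesis fd : finite_dimensional V.

Lemma seminorm_quotient_finite_dimensional :
  finite_dimensional (seminorm_quotient sp).
Proof.
case: fd => n [f spanf]; exists n, (sq_proj sp \o f) => x.
have [c xE] := spanf (sq_repr x); exists c.
rewrite -[LHS]sq_reprK xE linear_sum; apply: eq_bigr => i _.
by rewrite linearZ.
Qed.

(** The same space as [seminorm_quotient sp]; the proof [fd] occurs in the type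
    because the completeness instance depends on it. *)
Definition banach_quotient : Type :=
  (fun (_ : finite_dimensional V) => seminorm_quotient sp) fd.

HB.instance Definition _ := NormedModule.on banach_quotient.
HB.instance Definition _ := Uniform_isComplete.Build banach_quotient
  (finite_dimensional_complete seminorm_quotient_finite_dimensional).

End SeminormQuotientBanach.

(** The Gurarij property freed from its normed spaces: [U] may carry any seminorm
    extending the one pulled back from [G], so that tuples need not be linearly
    independent and new variables may be equated with old ones.  It is applied
    to the quotients of [V] and [U] by the vectors of seminorm zero. *)
Lemma gurarij_seminorm (R : realType) (G : completeNormedModType R) :
  gurarij G ->
  forall (V U : lmodType R) (h : {linear V -> G}) (i : {linear V -> U})
    (p : U -> R) (eps : R),
  finite_dimensional V -> finite_dimensional U -> seminorm p ->
  (forall v, p (i v) = `|h v|) -> 0 < eps ->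
  exists2 psi : {linear U -> G}, forall v, psi (i v) = h v &
    forall u, (1 - eps) * p u <= `|psi u| <= (1 + eps) * p u.
Proof.
move=> gG V U h i p eps fV fU sp pi eps0.
have sq : seminorm (p \o i).
  split=> [x y|a x] /=; first by rewrite linearD seminormD.
  by rewrite linearZ seminormZ.
have [phi phiP] := seminorm_quotient_lift sq (fun v => esym (pi v)).
have [j jP] := seminorm_quotient_lift sq
  (h := sq_proj sp \o i) (fun v => norm_sq_proj sp (i v)).
have [psi [psiP psi_iso]] :=
  gG _ eps0 (banach_quotient sq fV) (banach_quotient sp fU) j phi
  (seminorm_quotient_finite_dimensional sq fV)
    (seminorm_quotient_finite_dimensional sp fU).
exists (psi \o sq_proj sp) => [v|u] /=.
  by have := psiP (sq_proj sq v); rewrite phiP jP.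
by have := psi_iso (sq_proj sp u); rewrite norm_sq_proj.
Qed.

(** * Sequences with geometrically decreasing steps *)

Lemma lt_pow2 (R : realType) (c e : R) :
  0 <= c -> 0 < e -> exists k, c / 2 ^+ k < e.
Proof.
move=> c0 e0; exists (Num.bound (c / e)).
rewrite ltr_pdivrMr ?exprn_gt0// mulrC -ltr_pdivrMr//.
apply: (lt_trans (archi_boundP _)); first by rewrite divr_ge0// ltW.
by rewrite -natrX ltr_nat ltn_expl.
Qed.

Lemma geometric_cauchy_limit (R : realType) (G : completeNormedModType R)
    (u : nat -> G) (c : R) :
  0 <= c -> (forall k, `|u k.+1 - u k| <= c / 2 ^+ k) ->
  exists l, forall k, `|u k - l| <= 2 * c / 2 ^+ k.
Proof.
move=> c0 uc.
have pow_ge0 k : 0 <= c / 2 ^+ k by rewrite divr_ge0// exprn_ge0.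
have uk k m : `|u (k + m)%N - u k| <= 2 * c / 2 ^+ k - 2 * c / 2 ^+ (k + m).
  elim: m => [|m IH]; first by rewrite addn0 !subrr normr0.
  rewrite addnS -[u (k + m).+1](subrK (u (k + m)%N)) -addrA.
  apply: le_trans (ler_normD _ _) _; apply: le_trans (lerD (uc _) IH) _.
  have -> : 2 * c / 2 ^+ (k + m).+1 = c / 2 ^+ (k + m).
    by rewrite exprS -mulf_div divff// mul1r.
  rewrite -(mulrA 2 c (2 ^+ (k + m))^-1).
  lra.
have uk' k m : `|u (k + m)%N - u k| <= 2 * c / 2 ^+ k.
  by rewrite (le_trans (uk k m))// gerBl -mulrA mulr_ge0.
have /cauchy_cvg/cvg_ex[/= l ul] : cauchy (u @ \oo).
  apply: cauchy_exP => e e0.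
  have [k ke] := lt_pow2 (mulr_ge0 (ler0n _ 2) c0) e0.
  exists (u k); exists k => // m /= km; rewrite -ball_normE /= distrC.
  by rewrite -(subnKC km) (le_lt_trans (uk' _ _)).
exists l => k; apply/ler_addgt0Pr => e e0.
have [N _ Nl] : \forall m \near \oo, `|l - u m| < e by exact: cvgr_dist_lt.
have := Nl (k + N)%N (leq_addl _ _) => /= /ltW lu.
rewrite -[u k](subrK (u (k + N)%N)) -addrA (le_trans (ler_normD _ _))//.
by rewrite lerD// distrC.
Qed.

Lemma le_pow2_eq0 (R : realType) (x c : R) : 0 <= x -> 0 <= c ->
  (forall k, x <= c / 2 ^+ k) -> x = 0.
Proof.
move=> x0 c0 xc; apply/eqP; rewrite eq_le x0 andbT leNgt; apply/negP => xpos.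
by have [k /(le_lt_trans (xc k))] := lt_pow2 c0 xpos; rewrite ltxx.
Qed.

Lemma nat_dependent_choice (T : Type) (P : nat -> T -> Prop)
    (Q : nat -> T -> T -> Prop) (t0 : T) : P 0%N t0 ->
  (forall k t, P k t -> exists2 t', P k.+1 t' & Q k t t') ->
  exists s : nat -> T, s 0%N = t0 /\ forall k, P k (s k) /\ Q k (s k) (s k.+1).
Proof.
move=> P0 PS.
have /choice[S SP] : forall kt : nat * T, exists t', P kt.1 kt.2 ->
    P kt.1.+1 t' /\ Q kt.1 kt.2 t'.
  move=> [k t]; have [/PS[t' Pt' Qt']|nP] := pselect (P k t); first by
    exists t'.
  by exists t0.
pose s := fix s k := if k is k'.+1 then S (k', s k') else t0.
have Ps k : P k (s k) by elim: k => //= k /(SP (k, _))[].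
by exists s; split => // k; split => //; exact: (SP (k, s k) (Ps k)).2.
Qed.

(** * Types and their isolation *)

Definition l1norm (R : realType) n (v : 'rV[R]_n) : R := \sum_(i < n) `|v 0 i|.

Lemma l1norm_seminorm (R : realType) n : seminorm (@l1norm R n).
Proof.
split=> [v w|a v]; rewrite /l1norm.
  by rewrite -big_split; apply: ler_sum => i _; rewrite mxE ler_normD.
by rewrite mulr_sumr; apply: eq_bigr => i _; rewrite mxE normrM.
Qed.

Lemma l1norm_delta (R : realType) n (i : 'I_n) : l1norm (delta_mx 0 i) = 1 :> R.
Proof.
rewrite /l1norm (bigD1 i)//= big1 => [|j ji]; last
  by rewrite mxE (negPf ji) andbF normr0.
by rewrite addr0 mxE !eqxx normr1.
Qed.

(** What a bound [tdist xi zeta < d] says about the seminorms: if the tuples are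
    at distance at most [d], their linear combinations differ in norm by at most
    [d] times the sum of the absolute values of the coefficients. *)
Definition near_type (R : realType) (E : normedModType R) (n : nat) (d : R)
    (xi zeta : ntype E n) : Prop :=
  forall x, `|xi x - zeta x| <= d * l1norm x.2.

Lemma sum_dist_le (R : realType) (F : normedModType R) (n : nat) (x : F)
    (c : 'I_n -> R) (a b : 'I_n -> F) (d : R) : (forall i, `|a i - b i| <= d) ->
  `| `|x + \sum_(i < n) c i *: a i| - `|x + \sum_(i < n) c i *: b i| | <=
    d * \sum_(i < n) `|c i|.
Proof.
move=> abd; apply: le_trans (ler_dist_dist _ _) _.
rewrite opprD addrACA subrr add0r -sumrB mulr_sumr.
apply: le_trans (ler_norm_sum _ _ _) _; apply: ler_sum => i _.
by rewrite -scalerBr normrZ mulrC ler_wpM2r.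
Qed.

Lemma tp_near_type (R : realType) (E F : normedModType R) (j : embedding E F)
    (n : nat) (a b : 'I_n -> F) (d : R) :
  (forall i, `|a i - b i| <= d) -> near_type d (tp j a) (tp j b).
Proof. by move=> abd x; exact: sum_dist_le. Qed.

Lemma tdist_near_type (R : realType) (E : normedModType R) (n : nat) (d : R)
    (xi zeta : ntype E n) : (tdist xi zeta < d%:E)%E -> near_type d xi zeta.
Proof.
move=> /ereal_inf_lt[_ [F [j [a [b [<- <- ->]]]]]]; rewrite lte_fin => abd.
apply: tp_near_type => i; rewrite ltW// (le_lt_trans _ abd)//.
exact: (le_bigmax _ (fun i => `|a i - b i|)).
Qed.

(** The sets defined by finitely many approximate values form a filter that
    converges to [xi] for each of the initial topologies, hence for their
    supremum. *)
Lemma nbhs_ntype (R : realType) (E : normedModType R) (n : nat)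
    (xi : ntype E n) (V : set (ntype E n)) : nbhs xi V ->
  exists (xs : seq (E * 'rV[R]_n)) (eta : R), 0 < eta /\
    forall zeta : ntype E n,
      (forall x, x \in xs -> `|zeta x - xi x| < eta) -> V zeta.
Proof.
pose basic (p : seq (E * 'rV[R]_n) * R) : set (ntype E n) :=
  [set zeta | forall x, x \in p.1 -> `|zeta x - xi x| < p.2].
pose G := filter_from [set p | 0 < p.2] basic.
have FG : Filter G.
  apply: filter_from_filter; first by exists ([::], 1) => /=.
  move=> [s e] [t d] /= e0 d0; exists (s ++ t, Num.min e d) => /=.
    by rewrite lt_min e0.
  move=> zeta /= h; split => x /= xs; have := h x;
    rewrite mem_cat xs ?orbT => /(_ isT);
    by rewrite lt_min => /andP[].
have Gxi : G --> xi.
  apply/(cvg_sup _ xi) => x A /= [_ [[B oB <-] Bx] BA].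
  have /nbhs_ballP[e /= e0 eB] : nbhs (xi x) B by exact: open_nbhs_nbhs.
  exists ([:: x], e) => // zeta /= /(_ x); rewrite mem_head => /(_ isT) zx.
  by apply: BA; apply: eB; rewrite -ball_normE /= distrC.
by move=> /Gxi[[xs eta] /= eta0 h]; exists xs, eta.
Qed.

Lemma isolated_near_type (R : realType) (E : normedModType R) (n : nat)
    (xi : ntype E n) (d : R) : Defs.isolated xi -> 0 < d ->
  exists (xs : seq (E * 'rV[R]_n)) (eta : R), 0 < eta /\
    forall zeta : ntype E n,
      (forall x, x \in xs -> `|zeta x - xi x| < eta) -> near_type d xi zeta.
Proof.
move=> ixi d0.
have /ixi/nbhs_ntype[xs [eta [eta0 h]]] :
  metric_nbhs xi [set zeta | (tdist xi zeta < d%:E)%E] by exists d.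
by exists xs, eta; split => // zeta /h /tdist_near_type.
Qed.

Lemma ntype_seminorm (R : realType) (E : normedModType R) n (xi : ntype E n) :
  seminorm xi.
Proof. by split; [exact: tnormD|exact: tnormZ]. Qed.

Lemma near_typeP (R : realType) (E : normedModType R) n (d : R)
    (xi zeta : ntype E n) :
  near_type d xi zeta -> forall x, xi x <= d * l1norm x.2 + zeta x /\
    zeta x <= d * l1norm x.2 + xi x.
Proof.
move=> nd x; have := nd x; rewrite ler_norml => /andP[lo hi].
by split; [rewrite -lerBlDr|rewrite -lerBlDr -opprB lerNl].
Qed.

(** The largest seminorm on [E] plus two tuples of variables [g] and [z] that is
    at most [xi] on [(E, g)], at most [zeta] on [(E, z)] and makes each
    [g_i - z_i] at most [d].  In the formula for [N], the vector [x + w z] is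
    decomposed, for [y = (e, u)] and [x] in [(E, g)], as
    [(x - e - u g) + u (g - z) + (e + (u + w) z)].
    Closeness of [xi] and [zeta] is exactly what prevents the first two bounds
    from shrinking one another. *)
Lemma near_type_amalgam (R : realType) (E : normedModType R) n (d : R)
    (xi zeta : ntype E n) : 0 <= d -> near_type d zeta xi ->
  exists p : (E * 'rV[R]_n) * 'rV[R]_n -> R, [/\ seminorm p,
    forall x, p (x, 0) = xi x,
    forall e w, p ((e, 0), w) = zeta (e, w) &
    forall i, p ((0, delta_mx 0 i), - delta_mx 0 i) <= d].
Proof.
move=> d0 /near_typeP nd.
pose N (u : ((E * 'rV[R]_n) * 'rV[R]_n) * (E * 'rV[R]_n)) :=
  xi (u.1.1 - u.2) + d * l1norm u.2.2 + zeta (u.2 + (0, u.1.2)).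
have sx := ntype_seminorm xi; have sz := ntype_seminorm zeta.
have sl := l1norm_seminorm R n.
have sN : seminorm N.
  split=> [[[x v] y] [[x' v'] y']|a [[x v] y]]; rewrite /N /=.
    rewrite addrACA lerD//.
      rewrite addrACA lerD//; first by rewrite opprD addrACA seminormD.
      by rewrite -mulrDr ler_wpM2l// seminormD.
    have -> : (0, v + v') = (0, v) + (0, v') :> E * 'rV[R]_n.
      by congr pair; rewrite addr0.
    by rewrite addrACA seminormD.
  rewrite -scalerBr (seminormZ sx) (seminormZ sl).
  have -> : (0, a *: v) = a *: (0, v) :> E * 'rV[R]_n by congr pair;
    rewrite scaler0.
  by rewrite -scalerDr (seminormZ sz) mulrCA -!mulrDr.
have x0 : xi 0 = 0 := seminorm0 sx; have z0 : zeta 0 = 0 := seminorm0 sz.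
have l0 : l1norm (0 : 'rV[R]_n) = 0 := seminorm0 sl.
exists (inf_norm N); split; first exact: inf_norm_seminorm.
- move=> x; apply/eqP; rewrite eq_le; apply/andP; split.
    by rewrite (le_trans (inf_norm_le sN _ 0))//
      /N /= subr0 l0 mulr0 add0r z0 !addr0.
  apply: le_inf_norm => y; rewrite /N /= -/0 addr0 -addrA.
  rewrite -[x in xi x](subrK y) (le_trans (seminormD sx _ _))// lerD2l.
  exact: (nd y).2.
- move=> e w; apply/eqP; rewrite eq_le; apply/andP; split.
    rewrite (le_trans (inf_norm_le sN _ (e, 0)))//
      /N /= subrr x0 l0 mulr0 !add0r.
    by rewrite -[(e, 0) + _]/(e + 0, 0 + w) addr0 add0r.
  apply: le_inf_norm => y; rewrite /N /=.
  have -> : (e, w) = ((e, 0) - y) + (y + (0, w)).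
    by rewrite addrA subrK; congr pair; rewrite /= ?addr0 ?add0r.
  rewrite (le_trans (seminormD sz _ _))// lerD2r [leRHS]addrC.
  have -> : l1norm y.2 = l1norm ((e, 0) - y).2
    by rewrite /= add0r (seminormN sl).
  exact: (nd _).1.
- move=> i; rewrite (le_trans (inf_norm_le sN _ (0, delta_mx 0 i)))// /N /=.
  rewrite subrr x0 add0r l1norm_delta mulr1.
  rewrite -[(0, _) + _]/(0 + 0, delta_mx 0 i - delta_mx 0 i).
  by rewrite addr0 subrr z0 addr0.
Qed.

(** * Linear combinations of tuples *)

Lemma linear_bundle (R : realType) (V W : lmodType R) (f : V -> W) :
  linear f -> exists g : {linear V -> W}, forall x, g x = f x.
Proof.
move=> lf.
exists (HB.pack_for {linear V -> W} f (GRing.isLinear.Build R V W *:%R f lf)).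
by [].
Qed.

Definition lincomb (R : realType) (F : lmodType R) (n : nat) (a : 'I_n -> F)
  (v : 'rV[R]_n) : F := \sum_(i < n) v 0 i *: a i.

Lemma lincomb_linear (R : realType) (F : lmodType R) n (a : 'I_n -> F) :
  linear (lincomb a).
Proof.
move=> c v w; rewrite /lincomb scaler_sumr -big_split/=; apply: eq_bigr => i _.
by rewrite !mxE scalerDl scalerA.
Qed.

HB.instance Definition _ (R : realType) (F : lmodType R) n (a : 'I_n -> F) :=
  GRing.isLinear.Build R 'rV[R]_n F *:%R (lincomb a) (lincomb_linear a).

Lemma lincomb_delta (R : realType) (F : lmodType R) n (a : 'I_n -> F) i :
  lincomb a (delta_mx 0 i) = a i.
Proof.
rewrite /lincomb (bigD1 i)//= big1 ?addr0 => [|j ji].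
  by rewrite mxE !eqxx scale1r.
by rewrite mxE (negPf ji) andbF scale0r.
Qed.

Lemma finite_dimensional_rV (R : realType) n : finite_dimensional 'rV[R]_n.
Proof.
exists n, (fun i => delta_mx 0 i) => x; exists (fun i => x 0 i).
exact: row_sum_delta.
Qed.

Lemma finite_dimensional_prod (R : realType) (V W : lmodType R) :
  finite_dimensional V -> finite_dimensional W ->
  finite_dimensional (V * W)%type.
Proof.
move=> [m [f fP]] [n [g gP]]; exists (m + n)%N.
exists (fun i =>
  match fintype.split i with inl j => (f j, 0) | inr j => (0, g j) end) =>
    -[x y].
have [c ->] := fP x; have [d ->] := gP y.
exists (fun i => match fintype.split i with inl j => c j | inr j => d j end).
have sl k : fintype.split (lshift n k) = inl k :> 'I_m + 'I_n
  by exact: (unsplitK (inl k)).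
have sr k : fintype.split (rshift m k) = inr k :> 'I_m + 'I_n
  by exact: (unsplitK (inr k)).
rewrite big_split_ord.
rewrite [X in _ = X + _](eq_bigr (fun k => c k *: (f k, 0))) => [|k _];
  last by rewrite sl.
rewrite [X in _ = _ + X](eq_bigr (fun k => d k *: (0, g k))) => [|k _];
  last by rewrite sr.
rewrite [RHS]surjective_pairing /= !raddf_sum /=.
have -> : \sum_(k < n) d k *: (0 : V) = 0 
  by rewrite big1// => k _; rewrite scaler0.
have -> : \sum_(k < m) c k *: (0 : W) = 0
  by rewrite big1// => k _; rewrite scaler0.
by rewrite addr0 add0r.
Qed.

(** * Realising isolated types in Gurarij spaces *)

(** The seminorm [p] prescribes how new variables of type [zeta] relate to [E] and
    to the tuple [h] of [G].  By isolation, closeness to [zeta] depends on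
    finitely many vectors, so it is enough to realise [p] up to a factor
    [1 +- eps] over the span of [h] and of the finitely many elements of [E]
    occurring in these vectors.  The constant [2] bounds [1 + eps]. *)
Lemma isolated_extension (R : realType) (E G : completeNormedModType R)
    (i : embedding E G) (n m : nat) (zeta : ntype E n) (h : 'I_m -> G)
    (p : (E * 'rV[R]_m) * 'rV[R]_n -> R) (d : R) :
  gurarij G -> Defs.isolated zeta -> seminorm p ->
  (forall e v, p ((e, v), 0) = `|i e + lincomb h v|) ->
  (forall e w, p ((e, 0), w) = zeta (e, w)) -> 0 < d ->
  exists2 g : 'I_n -> G, near_type d zeta (tp i g) &
    forall v w, `|lincomb h v + lincomb g w| <= 2 * p ((0, v), w).
Proof.
move=> gG iz sp ph pz d0.
have [xs [eta [eta0 H]]] := isolated_near_type iz d0.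
pose q (k : 'I_(size xs)) : E := (tnth (in_tuple xs) k).1.
have z_ge0 x : 0 <= zeta x.
  by case: x => e w; rewrite -pz seminorm_ge0.
(* [eps] is such that a factor [1 +- eps] changes each [zeta x], for [x] in
   [xs], by less than [eta]. *)
pose S := \sum_(x <- xs) zeta x.
have S0 : 0 <= S by apply: sumr_ge0 => x _; exact: z_ge0.
have zS x : x \in xs -> zeta x <= S.
  by move=> xxs; rewrite /S (big_rem x)//= lerDl sumr_ge0// => y _;
    exact: z_ge0.
have S1 : 0 < S + 1 by rewrite ltr_wpDl.
pose eps := Num.min 1 (eta / (S + 1)).
have eps0 : 0 < eps by rewrite lt_min ltr01 divr_gt0.
have epsz x : x \in xs -> eps * zeta x < eta.
  move=> /zS zxS; apply: (@le_lt_trans _ _ (eta / (S + 1) * S)).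
    by rewrite ler_pM// ?ge_min ?lexx ?orbT// ltW.
  by rewrite mulrAC ltr_pdivrMr// ltr_pM2l// ltrDl.
pose V := ('rV[R]_(size xs) * 'rV[R]_m)%type; pose U := (V * 'rV[R]_n)%type.
have [hh hhE] : exists hh : {linear V -> G},
    forall v, hh v = i (lincomb q v.1) + lincomb h v.2.
  apply: linear_bundle => a x y /=.
  by rewrite !linearP/= scalerDr addrACA.
have [ii iiE] : exists ii : {linear V -> U}, forall v, ii v = (v, 0).
  by apply: linear_bundle => a x y; congr pair; rewrite /= scaler0 addr0.
have [qq qqE] : exists qq : {linear U -> ((E * 'rV[R]_m) * 'rV[R]_n)%type},
    forall u, qq u = ((lincomb q u.1.1, u.1.2), u.2).
  apply: linear_bundle => a x y; congr (_, _, _).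
  by rewrite /= linearP.
have fr := @finite_dimensional_rV R.
have [|psi psiE psiN] := gurarij_seminorm gG (h := hh) (i := ii) (p := p \o qq)
  (finite_dimensional_prod (fr _) (fr _))
  (finite_dimensional_prod (finite_dimensional_prod (fr _) (fr _)) (fr _))
  (seminorm_comp qq sp) _ eps0.
  by move=> v; rewrite /= qqE iiE hhE ph.
pose g j := psi (0, delta_mx 0 j).
have psig u v w : psi ((u, v), w) = i (lincomb q u) + lincomb h v + lincomb g w.
  have -> : ((u, v), w) = ii (u, v) + (0, w).
    by rewrite iiE; congr (_, _) => /=; rewrite ?addr0 ?add0r.
  rewrite linearD psiE hhE /=; congr (_ + _).
  have [kk kkE] : exists kk : {linear 'rV[R]_n -> G},
      forall w, kk w = psi (0, w).
    apply: linear_bundle => a x y; rewrite -linearP; congr (psi _).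
    by congr (_, _); rewrite /= scaler0 addr0.
  rewrite -kkE [in LHS](row_sum_delta w) linear_sum; apply: eq_bigr => j _.
  by rewrite linearZ /= kkE.
exists g; last first.
  move=> v w; have := psig 0 v w; rewrite linear0 linear0 add0r => <-.
  have /andP[_] := psiN ((0, v), w); rewrite /= qqE /= linear0 => /le_trans;
    apply.
  apply: ler_wpM2r; first exact: seminorm_ge0.
  by rewrite -[leRHS]/(1 + 1) lerD2l ge_min lexx.
apply: H => x xxs.
have kP : (index x xs < size xs)%N by rewrite index_mem.
have xE : x.1 = lincomb q (delta_mx 0 (Ordinal kP)).
  by rewrite lincomb_delta /q (tnth_nth x) /= nth_index.
have := psiN ((delta_mx 0 (Ordinal kP), 0), x.2).
rewrite psig /= qqE /= -xE pz linear0 addr0 -surjective_pairing => /andP[lo hi].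
apply: le_lt_trans (epsz _ xxs).
rewrite ler_norml /tp_norm; apply/andP; split.
  by move: lo; rewrite mulrBl mul1r lerBlDr lerNl opprB lerBlDr addrC.
by move: hi; rewrite mulrDl mul1r lerBlDl.
Qed.

Section Realization.
Variables (R : realType) (E G : completeNormedModType R) (i : embedding E G).
Hypothesis gG : gurarij G.
Variables (n : nat) (zeta : ntype E n).
Hypothesis iz : Defs.isolated zeta.

(** Applying [isolated_extension] to the amalgam of the type of [g] with [zeta]
    keeps the new tuple within [2 * d] of [g], while the new error
    [d'] is independent of [d]. *)
Lemma isolated_improve (g : 'I_n -> G) (d d' : R) :
  0 < d -> 0 < d' -> near_type d zeta (tp i g) ->
  exists2 g' : 'I_n -> G, near_type d' zeta (tp i g') &
    forall k, `|g' k - g k| <= 2 * d.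
Proof.
move=> d0 d'0 /(near_type_amalgam (ltW d0))[p [sp px pz pd]].
have [g' near_g' g'p] := 
  isolated_extension gG iz sp (fun e v => px (e, v)) pz d'0.
exists g' => // k; rewrite distrC; have := g'p (delta_mx 0 k) (- delta_mx 0 k).
rewrite linearN /= !lincomb_delta => /le_trans; apply.
by rewrite ler_pM2l.
Qed.

(** Iterating [isolated_improve] with errors [d / 2 ^ k]: the moves [2 * d / 2 ^ k]
    sum to [4 * d]. *)
Lemma isolated_realized (g : 'I_n -> G) (d : R) :
  0 < d -> near_type d zeta (tp i g) ->
  exists2 g' : 'I_n -> G, forall x, tp i g' x = zeta x &
    forall k, `|g' k - g k| <= 4 * d.
Proof.
move=> d0 nd; have dk k : 0 < d / 2 ^+ k by rewrite divr_gt0// exprn_gt0.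
have [|k t ndk|s [s0 sP]] := @nat_dependent_choice _
  (fun k (t : 'I_n -> G) => near_type (d / 2 ^+ k) zeta (tp i t))
  (fun k t t' => forall j, `|t' j - t j| <= 2 * d / 2 ^+ k) g.
- by rewrite expr0 divr1.
- by rewrite -(mulrA 2); exact: isolated_improve.
have /choice[g' g'P] : forall j, exists l,
    forall k, `|s k j - l| <= 2 * (2 * d) / 2 ^+ k.
  move=> j; apply: geometric_cauchy_limit => [|k]; first
    by rewrite mulr_ge0// ltW.
  exact: (sP k).2.
exists g' => [x|k]; last first.
  have := g'P k 0%N; rewrite s0 distrC expr0 divr1 mulrA -natrM; exact.
apply/eqP; rewrite -subr_eq0 -normr_eq0; apply/eqP.
have l0 := seminorm_ge0 (l1norm_seminorm R n) x.2.
apply: (@le_pow2_eq0 _ _ (5 * d * l1norm x.2)) => // [|k].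
  by rewrite !mulr_ge0// ltW.
have sz := (sP k).1 x.
have sg := tp_near_type i (fun j => g'P j k) x.
rewrite -[tp i g' x](subrK (tp i (s k) x)) -addrA (le_trans (ler_normD _ _))//.
rewrite [`|tp i g' x - _|]distrC [`|tp i (s k) x - zeta x|]distrC 
  (le_trans (lerD sg sz))//.
have -> : 5 * d * l1norm x.2 / 2 ^+ k = 5 * (d / 2 ^+ k * l1norm x.2).
  by rewrite -!mulrA [l1norm _ * _]mulrC.
have e1 m : m * d / 2 ^+ k * l1norm x.2 = m * (d / 2 ^+ k * l1norm x.2).
  by rewrite !mulrA.
rewrite [2 * (2 * d)]mulrA e1; lra.
Qed.

End Realization.

(** * Extending tuples of the same type *)

(** Equality of the types over [E] of the tuples of the first [N] terms; sequences
    spare the casts that tuples of growing length would need. *)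
Definition same_type (R : realType) (E G0 G1 : normedModType R)
    (i0 : embedding E G0) (i1 : embedding E G1) (N : nat)
    (a : nat -> G0) (b : nat -> G1) : Prop :=
  forall e (c : nat -> R), `|i0 e + \sum_(k < N) c k *: a k| =
    `|i1 e + \sum_(k < N) c k *: b k|.

Lemma same_type_sym (R : realType) (E G0 G1 : normedModType R)
    (i0 : embedding E G0) (i1 : embedding E G1) N a b :
  same_type i0 i1 N a b -> same_type i1 i0 N b a.
Proof. by move=> ab e c; rewrite ab. Qed.

(** [isolated_extension] is applied with [N.+1] new variables for the whole tuple
    [(a, x)], where the seminorm of [G0] identifies the first [N] of them with
    the variables standing for [b]: the tuple [g] obtained extends [b] exactly
    and has almost the right type.  Only the final correction moves [b]. *)
Lemma extend_same_type (R : realType) (E G0 G1 : completeNormedModType R)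
    (i0 : embedding E G0) (i1 : embedding E G1) N a b (x : G0) (eps : R) :
  atomic_over i0 -> gurarij G1 -> same_type i0 i1 N a b -> 0 < eps ->
  exists a' b', [/\ same_type i0 i1 N.+1 a' b', a' N = x,
    forall k, (k < N)%N -> a' k = a k &
    forall k, (k < N)%N -> `|b' k - b k| <= eps].
Proof.
move=> at0 gG1 ab eps0.
pose a' k := if (k < N)%N then a k else x.
pose A (k : 'I_N.+1) := a' k; pose aN (k : 'I_N) := a k.
pose bN (k : 'I_N) := b k.
pose p (u : (E * 'rV[R]_N) * 'rV[R]_N.+1) :=
  `|i0 u.1.1 + lincomb aN u.1.2 + lincomb A u.2|.
have sp : seminorm p.
  split=> [[[e v] w] [[e' v'] w']|c [[e v] w]]; rewrite /p /=.
    rewrite !linearD/= (le_trans _ (ler_normD _ _))//.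
    by rewrite [X in _ <= `|X|]addrACA [X in _ <= `|X + _|]addrACA.
  by rewrite !linearZ/= -!scalerDr normrZ.
have ph e v : p ((e, v), 0) = `|i1 e + lincomb bN v|.
  pose c k := if insub k is Some j then v 0 j else 0.
  have := ab e c; rewrite /p /= linear0 addr0 /lincomb.
  under eq_bigr do rewrite /c valK.
  by under [in RHS]eq_bigr do rewrite /c valK.
have pz e w : p ((e, 0), w) = tp i0 A (e, w) by rewrite /p /= linear0 addr0.
have eps4 : 0 < eps / 4 by rewrite divr_gt0.
have iA : Defs.isolated (tp i0 A) := at0 _ A.
have [g near_g gp] := isolated_extension gG1 iA sp ph pz eps4.
have [g' g'A g'g] := isolated_realized gG1 iA eps4 near_g.
exists a', (fun k => g' (inord k)); split.
- move=> e c; have := g'A (e, \row_k c k); rewrite /= /tp_norm /=.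
  under eq_bigr do rewrite mxE; under [in RHS]eq_bigr do rewrite mxE.
  by move=> <-; congr (`|_ + _|); apply: eq_bigr => k _; rewrite inord_val.
- by rewrite /a' ltnn.
- by move=> k kN; rewrite /a' kN.
- move=> k kN.
  (* The variables for [b k] and for the [k]-th term of [(a, x)] differ by a
     vector of seminorm zero. *)
  have -> : b k = g (inord k).
    apply/eqP; rewrite -subr_eq0 -normr_le0.
    have := gp (delta_mx 0 (Ordinal kN)) (- delta_mx 0 (inord k)).
    rewrite linearN /= !lincomb_delta /p /= linear0 linearN /= !lincomb_delta
      add0r.
    have kN1 : (k < N.+1)%N by rewrite ltnS ltnW.
    by rewrite /aN /A /a' /= inordK// kN subrr normr0 mulr0.
  by rewrite (le_trans (g'g _))// mulrC divfK.
Qed.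

(** * Isometries between dense sequences *)

Lemma separable_enum (T : topologicalType) (x0 : T) : separable T ->
  exists u : nat -> T,
    forall O : set T, open O -> O !=set0 -> exists k, O (u k).
Proof.
move=> [D /pfcard_geP[D0|[f]] dD].
  by have [|x] := dD setT _ openT; [exists x0|rewrite D0 => -[]].
exists f => O oO O0; have [x [Ox /(@surj _ _ _ _ f)[k _ fk]]] := dD O O0 oO.
by exists k; rewrite fk.
Qed.

Lemma separable_normed_enum (R : realType) (G : normedModType R) :
  separable G ->
  exists u : nat -> G, forall x (e : R), 0 < e -> exists k, `|x - u k| < e.
Proof.
move=> /(separable_enum 0)[u uP]; exists u => x e e0.
have [||k] := uP (ball x e); first exact: ball_open.
  by exists x; exact: ballxx.
by rewrite -ball_normE; exists k.
Qed.

Lemma comb3_dist_le (R : realType) (G : normedModType R) (c e : R)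
    (z z' z'' w w' w'' : G) :
  `|z - w| < e -> `|z' - w'| < e -> `|z'' - w''| < e ->
  `| `|c *: z + z' - z''| - `|c *: w + w' - w''| | <= (`|c| + 2) * e.
Proof.
move=> zw zw' zw''; apply: le_trans (ler_dist_dist _ _) _.
have -> : c *: z + z' - z'' - (c *: w + w' - w'') =
    c *: (z - w) + (z' - w') - (z'' - w'').
  rewrite scalerBr (opprB z'') [w'' - z'']addrC opprD opprK [LHS]addrACA.
  by rewrite opprD [X in X + _]addrACA.
apply: le_trans (ler_normB _ _) _;
  apply: le_trans (lerD (ler_normD _ _) (lexx _)) _.
rewrite normrZ mulrDl -addrA lerD//; first by rewrite ler_wpM2l// ltW.
by rewrite mulr_natl mulr2n lerD// ltW.
Qed.

(** The closure in [G0 * G1] of the set of pairs [(al k, be k)]: the graph of the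
    isometry to be built. *)
Definition matched (R : realType) (G0 G1 : normedModType R) (al : nat -> G0)
    (be : nat -> G1) (x : G0) (y : G1) : Prop :=
  forall e : R, 0 < e -> exists k, `|x - al k| < e /\ `|y - be k| < e.

Lemma matched_sym (R : realType) (G0 G1 : normedModType R) (al : nat -> G0)
    (be : nat -> G1) x y : matched al be x y -> matched be al y x.
Proof. by move=> xy e /xy[k [? ?]]; exists k. Qed.

Lemma matched_total (R : realType) (G0 G1 : completeNormedModType R)
    (al : nat -> G0) (be : nat -> G1) :
  (forall x (e : R), 0 < e -> exists k, `|x - al k| < e) ->
  (forall i j, `|al i - al j| = `|be i - be j|) ->
  forall x, exists y, matched al be x y.
Proof.
move=> dal isom x; have pow0 n : 0 < 1 / 2 ^+ n :> R.
  by rewrite divr_gt0// exprn_gt0.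
have /choice[k kP] : forall n, exists k, `|x - al k| < 1 / 2 ^+ n.
  by move=> n; exact: dal.
have [//|n|y yP] := @geometric_cauchy_limit _ _ (be \o k) 2.
  rewrite /= -isom -[al (k n.+1)](subrK x) -addrA (le_trans (ler_normD _ _))//.
  have -> : 2 / 2 ^+ n = 1 / 2 ^+ n + 1 / 2 ^+ n :> R by lra.
  rewrite lerD// ?[`|_ - x|]distrC ltW//; apply: lt_le_trans (kP _) _.
  by rewrite ler_pM2l// lef_pV2 ?posrE ?exprn_gt0//
    exprS ler_peMl ?exprn_ge0// ler1n.
exists y => e e0; have [n ne] := lt_pow2 (ler0n _ 4 : 0 <= 4 :> R) e0.
exists (k n); split.
  apply: lt_trans (kP n) _; apply: le_lt_trans ne.
  by rewrite ler_pM2r ?invr_gt0 ?exprn_gt0// ler1n.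
by rewrite distrC (le_lt_trans (yP n))// -natrM.
Qed.

Section DenseIsometry.
Variables (R : realType) (G0 G1 : completeNormedModType R).
Variables (al : nat -> G0) (be : nat -> G1).
Hypothesis isom : forall (c : R) i j k,
  `|c *: al i + al j - al k| = `|c *: be i + be j - be k|.

(** Preserving the norms of these three-term combinations gives at once that
    [matched] is functional, isometric and linear. *)
Lemma matched_isometry (c : R) x x' x'' y y' y'' :
  matched al be x y -> matched al be x' y' -> matched al be x'' y'' ->
  `|c *: x + x' - x''| = `|c *: y + y' - y''|.
Proof.
move=> xy xy' xy''; apply/eqP; rewrite -subr_eq0 -normr_eq0; apply/eqP.
have C0 : 0 <= 2 * (`|c| + 2) by rewrite mulr_ge0// addr_ge0.
apply: (le_pow2_eq0 _ C0) => // m.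
have em : 0 < (2 ^+ m)^-1 :> R by rewrite invr_gt0 exprn_gt0.
have [i [xi yi]] := xy _ em; have [j [xj yj]] := xy' _ em.
have [k [xk yk]] := xy'' _ em.
have := comb3_dist_le c xi xj xk; have := comb3_dist_le c yi yj yk.
rewrite -isom -mulrA; move: ((_ + _) * _) => d; rewrite !ler_norml; lra.
Qed.

Lemma matched_unique x y y' : matched al be x y -> matched al be x y' -> y = y'.
Proof.
move=> xy xy'; apply/eqP; rewrite -subr_eq0 -normr_eq0.
have := matched_isometry 0 xy xy xy'.
by rewrite !scale0r !add0r subrr normr0 => <-.
Qed.

Hypothesis dense_al : forall x (e : R), 0 < e -> exists k, `|x - al k| < e.
Hypothesis dense_be : forall y (e : R), 0 < e -> exists k, `|y - be k| < e.

Lemma matched_isomorphism : exists psi : embedding G0 G1,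
  bijective psi /\ forall x y, matched al be x y -> psi x = y.
Proof.
have dist i j : `|al i - al j| = `|be i - be j|.
  by have := isom 0 i i j; rewrite !scale0r !add0r.
have /choice[f fP] := matched_total dense_al dist.
have /choice[g /= gP] := matched_total dense_be (fun i j => esym (dist i j)).
have flin : linear f.
  move=> c x x'; apply/eqP; rewrite eq_sym -subr_eq0 -normr_eq0.
  by rewrite -(matched_isometry c (fP x) (fP x') (fP _)) subrr normr0.
have [F FE] := linear_bundle flin.
have Fiso x : `|F x| = `|x|.
  have := matched_isometry 1 (fP x) (fP 0) (fP 0).
  by rewrite !addrK !scale1r FE.
exists (Embedding Fiso); split => [|x y xy].
  exists g => z /=.
    have := matched_isometry 0 (fP z) (fP z) (matched_sym (gP (F z))).
    rewrite !scale0r !add0r FE subrr normr0 => /eqP.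
    by rewrite normr_eq0 subr_eq0 => /eqP.
  by rewrite FE; exact: matched_unique (fP _) (matched_sym (gP z)).
by rewrite /= FE; exact: matched_unique (fP x) xy.
Qed.

End DenseIsometry.

(** * Back-and-forth *)

(** Used to schedule requests: stage [k] serves request [logn 2 k.+1], so that each
    one is served at arbitrarily late stages. *)
Lemma logn2_infinitely_often (a M : nat) :
  exists2 k, (M <= k)%N & logn 2 k.+1 = a.
Proof.
have pos : (0 < 2 ^ a * 3 ^ M)%N by rewrite muln_gt0 !expn_gt0.
(* [k.+1 = 2 ^ a * 3 ^ M] has 2-adic valuation [a] and exceeds [M]. *)
exists (2 ^ a * 3 ^ M).-1; last first.
  by rewrite prednK// lognM ?expn_gt0// !lognX /= muln1 muln0 addn0.
rewrite -ltnS prednK// (leq_trans (ltn_expl M (isT : 1 < 3)%N))//.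
by rewrite leq_pmull// expn_gt0.
Qed.

Section BackAndForth.
Variables (R : realType) (E G0 G1 : completeNormedModType R).
Variables (i0 : embedding E G0) (i1 : embedding E G1).
Hypotheses (gur0 : gurarij G0) (gur1 : gurarij G1).
Hypotheses (at0 : atomic_over i0) (at1 : atomic_over i1).

Lemma back_and_forth_step (n : nat) (a : nat -> G0) (b : nat -> G1) (eps : R)
    (back : bool) (x : G0) (y : G1) :
  same_type i0 i1 n a b -> 0 < eps ->
  exists a' b', [/\ same_type i0 i1 n.+1 a' b',
    if back then b' n = y else a' n = x,
    forall k, (k < n)%N -> `|a' k - a k| <= eps &
    forall k, (k < n)%N -> `|b' k - b k| <= eps].
Proof.
move=> ab eps0; case: back.
  have [b' [a' [ab' b'y b'b a'a]]] :=
    extend_same_type y at1 gur0 (same_type_sym ab) eps0.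
  exists a', b'; split; [exact: same_type_sym| exact: b'y|exact: a'a|].
  by move=> k /b'b ->; rewrite subrr normr0 ltW.
have [a' [b' [ab' a'x a'a b'b]]] := extend_same_type x at0 gur1 ab eps0.
exists a', b'; split => //.
by move=> k /a'a ->; rewrite subrr normr0 ltW.
Qed.

(** Row [k] of [s] stands for a tuple of length [n + k]; column [l] is controlled,
    hence converges geometrically, from the first row that is longer than [l]. *)
Lemma stabilizing_limit (G : completeNormedModType R) (s : nat -> nat -> G)
    (n : nat) (eps : R) : 0 <= eps ->
  (forall k l, (l < n + k)%N -> `|s k.+1 l - s k l| <= eps / 2 ^+ k) ->
  exists al : nat -> G, forall k l, (l < n + k)%N ->
    `|s k l - al l| <= 2 * eps / 2 ^+ k.
Proof.
move=> eps0 sP; suff /choice[al alP] : forall l, exists x,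
    forall k, (l < n + k)%N -> `|s k l - x| <= 2 * eps / 2 ^+ k.
  by exists al => k l; exact: alP.
move=> l; pose k0 := (l.+1 - n)%N.
have e2 m : eps / 2 ^+ k0 / 2 ^+ m = eps / 2 ^+ (k0 + m).
  by rewrite exprD invfM mulrA.
have [|m|x xP] := @geometric_cauchy_limit _ _ (fun m => s (k0 + m)%N l)
  (eps / 2 ^+ k0).
- by rewrite divr_ge0// exprn_ge0.
- rewrite e2 addnS; apply: sP.
  by rewrite addnA (leq_trans _ (leq_addr _ _))// -leq_subLR.
exists x => k lk; have := xP (k - k0)%N; rewrite subnKC ?leq_subLR//.
by rewrite -mulrA e2 subnKC ?leq_subLR// mulrA.
Qed.

(** A request is served exactly when it is made and perturbed afterwards by at
    most [2 * eps / 2 ^ k].  Since each request recurs at late stages, the limit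
    sequences come arbitrarily close to every term of [u] and [v]. *)
Lemma back_and_forth (n : nat) (a : nat -> G0) (b : nat -> G1) (eps : R)
    (u : nat -> G0) (v : nat -> G1) :
  same_type i0 i1 n a b -> 0 < eps ->
  exists (al : nat -> G0) (be : nat -> G1),
    [/\ forall N, same_type i0 i1 N al be,
      forall k, (k < n)%N -> `|a k - al k| <= 2 * eps /\
        `|b k - be k| <= 2 * eps,
      forall j (e : R), 0 < e -> exists k, `|u j - al k| < e &
      forall j (e : R), 0 < e -> exists k, `|v j - be k| < e].
Proof.
move=> ab eps0.
have epsk k : 0 < eps / 2 ^+ k by rewrite divr_gt0// exprn_gt0.
have [|k [a' b'] /= ab'|s [s0 sP]] := @nat_dependent_choice _
  (fun k (t : (nat -> G0) * (nat -> G1)) => same_type i0 i1 (n + k) t.1 t.2)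
  (fun k t t' => [/\ let j := logn 2 k.+1 in
      if odd j then t'.2 (n + k)%N = v j./2 else t'.1 (n + k)%N = u j./2,
    forall l, (l < n + k)%N -> `|t'.1 l - t.1 l| <= eps / 2 ^+ k &
    forall l, (l < n + k)%N -> `|t'.2 l - t.2 l| <= eps / 2 ^+ k]) (a, b).
- by rewrite addn0.
- have [a'' [b'' [? ? ? ?]]] := back_and_forth_step (odd (logn 2 k.+1))
    (u (logn 2 k.+1)./2) (v (logn 2 k.+1)./2) ab' (epsk k).
  by exists (a'', b''); rewrite ?addnS.
have [al alP] := @stabilizing_limit _ (fun k => (s k).1) n _ (ltW eps0)
  (fun k l => let: And3 _ h _ := (sP k).2 in h l).
have [be beP] := @stabilizing_limit _ (fun k => (s k).2) n _ (ltW eps0)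
  (fun k l => let: And3 _ _ h := (sP k).2 in h l).
have late (e : R) j : 0 < e ->
    exists2 k, logn 2 k.+1 = j & 2 * eps / 2 ^+ k.+1 < e.
  move=> e0; have [M Me] := lt_pow2 (ltW (mulr_gt0 (ltr0n _ 2) eps0)) e0.
  have [k Mk kj] := logn2_infinitely_often j M; exists k => //.
  apply: le_lt_trans Me; rewrite ler_pM2l ?mulr_gt0//
    lef_pV2 ?posrE ?exprn_gt0//.
  by rewrite ler_eXn2l ?ltr1n// leqW.
exists al, be; split.
(* At stage [N + k] the first [N] terms have the same type on both sides and are
   within [2 * eps / 2 ^ (N + k)] of their limits. *)
- move=> N e c; apply/eqP; rewrite -subr_eq0 -normr_eq0; apply/eqP.
  pose C := \sum_(k < N) `|c k|; have C0 : 0 <= C by exact: sumr_ge0.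
  apply: (@le_pow2_eq0 _ _ (4 * eps * C / 2 ^+ N)) => // [|k].
    by rewrite divr_ge0 ?exprn_ge0// !mulr_ge0// ltW.
  have lk (l : 'I_N) : (l < n + (N + k))%N.
    by rewrite addnCA ltn_addr.
  have lk' (l : 'I_N) := alP (N + k)%N l (lk l).
  have lk'' (l : 'I_N) := beP (N + k)%N l (lk l).
  have ha := sum_dist_le (i0 e) c lk'; have hb := sum_dist_le (i1 e) c lk''.
  have hs : `|i0 e + \sum_(l < N) c l *: (s (N + k)%N).1 l| =
      `|i1 e + \sum_(l < N) c l *: (s (N + k)%N).2 l|.
    pose c' l := if (l < N)%N then c l else 0.
    have trunc (G : lmodType R) (z : nat -> G) :
        \sum_(l < n + (N + k)) c' l *: z l = \sum_(l < N) c l *: z l.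
      have NK : (N <= n + (N + k))%N by rewrite addnCA leq_addr.
      rewrite [RHS](big_ord_widen _ (fun l => c l *: z l) NK) [RHS]big_mkcond.
      by apply: eq_bigr => l _; rewrite /c'; case: ifP; rewrite ?scale0r.
    by have := (sP (N + k)%N).1 e c'; rewrite !trunc.
  have -> : 4 * eps * C / 2 ^+ N / 2 ^+ k = 2 * (2 * eps / 2 ^+ (N + k) * C).
    by rewrite exprD invfM; lra.
  move: ha hb; rewrite hs -/C; move: (_ * C) => d; rewrite !ler_norml; lra.
- move=> k kn; have := alP 0%N k; have := beP 0%N k.
  by rewrite s0 expr0 divr1 addn0 => /(_ kn) ? /(_ kn) ?.
- move=> j e /(late _ j.*2)[k kj ke]; exists (n + k)%N.
  have [+ _ _] := (sP k).2; rewrite kj; cbv zeta;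
    rewrite odd_double doubleK => <-.
  by rewrite (le_lt_trans (alP k.+1 _ _))// addnS.
- move=> j e /(late _ j.*2.+1)[k kj ke]; exists (n + k)%N.
  have [+ _ _] := (sP k).2; rewrite kj; cbv zeta;
    rewrite oddS odd_double (uphalf_double j : j.*2.+1./2 = j) => <-.
  by rewrite (le_lt_trans (beP k.+1 _ _))// addnS.
Qed.

Hypotheses (sep0 : Defs.separable G0) (sep1 : Defs.separable G1).

Lemma back_and_forth_isomorphism (n : nat) (a : nat -> G0) (b : nat -> G1)
    (eps : R) :
  same_type i0 i1 n a b -> 0 < eps ->
  exists psi : embedding G0 G1, [/\ bijective psi, forall e, psi (i0 e) = i1 e &
    forall k, (k < n)%N -> `|psi (a k) - b k| <= 4 * eps].
Proof.
move=> ab eps0.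
have [u uP] := separable_normed_enum sep0.
have [v vP] := separable_normed_enum sep1.
have [al [be [same ab_al u_al v_be]]] := back_and_forth u v ab eps0.
have half (G : normedModType R) (w ga : nat -> G) :
    (forall x (e : R), 0 < e -> exists k, `|x - w k| < e) ->
    (forall j (e : R), 0 < e -> exists k, `|w j - ga k| < e) ->
    forall x (e : R), 0 < e -> exists k, `|x - ga k| < e.
  move=> wP w_ga x e e0; have e20 : 0 < e / 2 by rewrite divr_gt0.
  have [j xj] := wP x _ e20; have [k jk] := w_ga j _ e20; exists k.
  rewrite -[x](subrK (w j)) -addrA (le_lt_trans (ler_normD _ _))//.
  by rewrite [ltRHS]splitr ltrD.
have dal := half _ _ _ uP u_al; have dbe := half _ _ _ vP v_be.
pose delta (i l : nat) : R := (l == i)%:R.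
have sum_delta (G : lmodType R) (ga : nat -> G) N i : (i < N)%N ->
    \sum_(l < N) delta i l *: ga l = ga i.
  move=> iN; rewrite (bigD1 (Ordinal iN))//= big1 /delta ?eqxx ?scale1r
    ?addr0//.
  by move=> l; rewrite -val_eqE /= => /negPf ->; rewrite scale0r.
have isom (c : R) i j k :
  `|c *: al i + al j - al k| = `|c *: be i + be j - be k|.
  pose N := (i + j + k).+1.
  have iN : (i < N)%N by rewrite ltnS -addnA leq_addr.
  have jN : (j < N)%N by rewrite ltnS addnAC leq_addl.
  have kN : (k < N)%N by rewrite ltnS leq_addl.
  have comb (G : lmodType R) (ga : nat -> G) :
      \sum_(l < N) (c * delta i l + delta j l - delta k l) *: ga l =
      c *: ga i + ga j - ga k.
    under eq_bigr do rewrite scalerBl scalerDl -scalerA.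
    by rewrite sumrB big_split/= -scaler_sumr !sum_delta.
  have := same N 0 (fun l => c * delta i l + delta j l - delta k l).
  by rewrite !comb !linear0 !add0r.
have [psi [psi_bij psiP]] := matched_isomorphism isom dal dbe.
have psi_al k : psi (al k) = be k.
  by apply: psiP => e e0; exists k; rewrite !subrr !normr0.
exists psi; split => // [e|k kn].
  apply: psiP => d d0; have [k kP] := dal (i0 e) d d0; exists k; split => //.
  have := same k.+1 e (fun l => - delta k l).
  under eq_bigr do rewrite scaleNr; under [in RHS]eq_bigr do rewrite scaleNr.
  by rewrite !sumrN !sum_delta// => <-.
have [akal bkbe] := ab_al k kn.
have -> : psi (a k) - b k = psi (a k - al k) - (b k - be k).
  by rewrite linearB psi_al opprB addrA subrK.
rewrite (le_trans (ler_normB _ _))// emb_isometric; move: akal bkbe; lra.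
Qed.

End BackAndForth.

(** * Operator norm estimate and conclusion *)

Lemma embedding_range_submodule (R : realType) (E F : normedModType R)
    (j : embedding E F) : submodule (range j).
Proof.
split; first by exists 0 => //; rewrite linear0.
by move=> a _ _ [x _ <-] [y _ <-]; exists (a *: x + y) => //; rewrite linearP.
Qed.

Lemma embedding_range_complete (R : realType) (E : completeNormedModType R)
    (F : normedModType R) (j : embedding E F) : complete_set (range j).
Proof.
move=> G PG GS cG; pose g x := xget 0 [set e | j e = x].
have jg x : range j x -> j (g x) = x.
  by move=> [e _ ex]; apply: (@xgetPex _ 0 [set e | j e = x]); exists e.
have glip x y : range j x -> range j y -> `|g x - g y| <= 1 * `|x - y|.
  by move=> /jg gx /jg gy; rewrite mul1r -(emb_isometric j) linearB gx gy.
have /cauchy_cvg/cvg_ex[/= e ge] := cauchy_lipschitz PG glip GS cG.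
exists (j e); first by exists e.
move=> B /nbhs_ballP[d /= d0 dB].
have Gd : G [set x | `|e - g x| < d].
  by move/cvgrPdist_lt: ge => /(_ d d0).
apply: filterS (filterI GS Gd) => x [/jg jgx /= egx].
by apply: dB; rewrite -ball_normE /= -jgx -linearB emb_isometric.
Qed.

Lemma finite_codimensional_bounded_coeffs (R : realType)
    (E : completeNormedModType R) (F : normedModType R) (j : embedding E F) :
  finite_codimensional j ->
  exists n (f : 'I_n -> F) (C : R), 0 <= C /\
    forall x, exists e (c : 'I_n -> R),
    x = j e + \sum_(i < n) c i *: f i /\ \sum_(i < n) `|c i| <= C * `|x|.
Proof.
move=> [n [f spanf]]; exists n, f.
have [_ [C C0 CP]] := complete_add_span f
  (embedding_range_submodule j) (@embedding_range_complete _ _ _ j).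
exists C; split => // x; have [|_ [e _ <-] [c xE cC]] := CP x; last by
  exists e, c.
have [e [c ->]] := spanf x; exists (j e); first by exists e.
by exists c.
Qed.

Theorem theorem2p6 (R : realType) (E G0 G1 : completeNormedModType R)
    (i0 : embedding E G0) (i1 : embedding E G1)
    (sep0 : separable G0) (sep1 : separable G1)
    (gur0 : gurarij G0) (gur1 : gurarij G1)
    (at0 : atomic_over i0) (at1 : atomic_over i1) :
  (forall (F : normedModType R) (j : embedding E F) (k : embedding F G0)
          (phi : embedding F G1) (eps : R),
     (forall e : E, k (j e) = i0 e) ->
     finite_codimensional j ->
     (forall e : E, phi (j e) = i1 e) ->
     0 < eps ->
     exists psi : embedding G0 G1,
       [/\ bijective psi,
           forall e : E, psi (i0 e) = i1 e &
           (opnorm (fun x : F => psi (k x) - phi x)%R < eps%:E)%E]) /\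
  (exists psi : embedding G0 G1,
     bijective psi /\ forall e : E, psi (i0 e) = i1 e).
Proof.
split; last first.
  have same0 : same_type i0 i1 0 (fun=> 0) (fun=> 0).
    by move=> e c; rewrite !big_ord0 !addr0 !emb_isometric.
  have [psi [psi_bij psi_i _]] :=
    back_and_forth_isomorphism gur0 gur1 at0 at1 sep0 sep1 same0 ltr01.
  by exists psi.
move=> F j k phi eps kj fj phij eps0.
have [n [f [C [C0 coeffs]]]] := finite_codimensional_bounded_coeffs fj.
pose a l := if insub l is Some i then k (f (i : 'I_n)) else 0.
pose b l := if insub l is Some i then phi (f (i : 'I_n)) else 0.
have aE (l : 'I_n) : a l = k (f l) by rewrite /a valK.
have bE (l : 'I_n) : b l = phi (f l) by rewrite /b valK.
have same_ab : same_type i0 i1 n a b.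
  move=> e c; under eq_bigr do rewrite aE; under [in RHS]eq_bigr do rewrite bE.
  transitivity `|j e + \sum_(l < n) c l *: f l|.
    rewrite -(emb_isometric k) linearD kj linear_sum.
    by congr (`|_ + _|); apply: eq_bigr => l _; rewrite linearZ.
  rewrite -(emb_isometric phi) linearD phij linear_sum.
  by congr (`|_ + _|); apply: eq_bigr => l _; rewrite linearZ.
(* Each [psi (a l)] is within [4 * d] of [b l], so the operator norm is at most
   [4 * d * C <= eps / 2]; the [+ 1] covers [C = 0]. *)
pose d := eps / (8 * (C + 1)).
have d0 : 0 < d by rewrite divr_gt0// mulr_gt0// ltr_wpDl.
have [psi [psi_bij psi_i psi_ab]] :=
  back_and_forth_isomorphism gur0 gur1 at0 at1 sep0 sep1 same_ab d0.
exists psi; split => //.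
apply: (@le_lt_trans _ _ (eps / 2)%:E); last first.
  by rewrite lte_fin ltr_pdivrMr// ltr_pMr// ltr1n.
apply: ge_ereal_sup => _ [x /= x1 <-]; rewrite lee_fin.
have [e [c [xE cC]]] := coeffs x.
have -> : psi (k x) - phi x = \sum_(l < n) c l *: (psi (a l) - b l).
  rewrite xE (linearD k) (linearD phi) linearD kj phij psi_i.
  rewrite opprD addrACA subrr add0r (linear_sum k) (linear_sum phi) linear_sum
    -sumrB.
  by apply: eq_bigr => l _;
    rewrite [k _]linearZ [phi _]linearZ [psi _]linearZ -scalerBr aE bE.
apply: le_trans (ler_norm_sum _ _ _) _.
apply: (@le_trans _ _ (\sum_(l < n) `|c l| * (4 * d))).
  by apply: ler_sum => l _; rewrite normrZ ler_wpM2l// psi_ab.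
have d4 : 0 <= 4 * d by rewrite mulr_ge0// ltW.
rewrite -mulr_suml; apply: le_trans (ler_wpM2r d4 cC) _.
have CC : C * `|x| <= C + 1 by rewrite (le_trans (ler_piMr C0 x1))// lerDl.
apply: le_trans (ler_wpM2r d4 CC) _.
have C1 : C + 1 != 0 by rewrite gt_eqF// ltr_wpDl.
by rewrite /d le_eqVlt; apply/orP; left; apply/eqP; field.
Qed.
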